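(* Let $\Gamma(z)=Cz-D$ ($z\in\mathbb{C}^n$) for some matrix $C\in\mathcal{M}(n)$ with $\|C\|\le 1$ and $D\in\mathbb{C}^n$, such that $C_\Gamma$ is bounded on $F_\psi^2$. Then $C_\Gamma$ is a co-isometry on $F_\psi^2$ if and only if $D=0$ and $C$ is unitary.
   Context: Let $n\ge 1$. On $\mathbb{C}^n$ write $\langle w,z\rangle=\sum_{j=1}^n w_j\overline{z_j}$ and $|w|^2=\langle w,w\rangle$. $\mathcal{M}(n)$ is the set of complex $n\times n$ matrices and $\|C\|$ is the operator norm of $C$ induced by $|\cdot|$. Weight: $\psi:[0,\infty)\to[0,\infty)$ is a $C^3$ function with $\psi'(y)>0$, $\psi''(y)\ge 0$, $\psi'''(y)\ge 0$ for all $y\ge 0$. Moreover there is a real number $l<\tfrac12$ such that, with $\phi(y)=y\psi'(y)$, $\phi''(y)=O\big(y^{-1/2}[\phi'(y)]^{1+l}\big)$ as $y\to\infty$; when $n>1$ it is also assumed that $\psi''(y)=O\big(y^{-1/2}[\psi'(y)]^{1+l}\big)$ as $y\to\infty$. Space: $F_\psi^2$ is the Hilbert space of holomorphic functions $g:\mathbb{C}^n\to\mathbb{C}$ with $\int_{\mathbb{C}^n}|g(z)|^2e^{-\psi(|z|^2)}\,d\mu(z)<\infty$, with inner product $\langle g,h\rangle_\psi=\int_{\mathbb{C}^n} g(z)\overline{h(z)}e^{-\psi(|z|^2)}\,d\mu(z)$, where $\mu$ is Lebesgue measure on $\mathbb{C}^n$. For a holomorphic map $\Gamma:\mathbb{C}^n\to\mathbb{C}^n$,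 the composition operator is $C_\Gamma f=f\circ\Gamma$. ''Bounded on $F_\psi^2$'' means that the operator maps $F_\psi^2$ into itself and is a bounded linear operator. A bounded operator $S$ on a Hilbert space $H$ is a co-isometry if $S^*$ is an isometry, equivalently $SS^*=I_H$. *)

(* Defs.v *)
From HB Require Import structures.
From mathcomp Require Import all_boot all_order all_algebra.
From mathcomp Require Import complex.
From mathcomp Require Import all_classical all_reals all_analysis.

Set Implicit Arguments.
Unset Strict Implicit.
Unset Printing Implicit Defensive.

Import Order.TTheory GRing.Theory Num.Theory.
Import numFieldNormedType.Exports.

Local Open Scope classical_set_scope.
Local Open Scope ring_scope.

(* Product of n copies of a sigma-finite measure, on the product
   sigma-algebra of n.-tuple T. *)
Section tuple_measure.
Local Open Scope ereal_scope.
Context d (T : measurableType d) (R : realType).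
Variable m : {sigma_finite_measure set T -> \bar R}.

Definition tuple_cons n (p : T * n.-tuple T) : n.+1.-tuple T :=
  [tuple of p.1 :: p.2].

Lemma measurable_tuple_cons n : measurable_fun setT (@tuple_cons n).
Proof. exact: measurable_cons. Qed.

Section step.
Variables (n : nat) (mu : {sigma_finite_measure set (n.-tuple T) -> \bar R}).

Definition tuple_measureS := pushforward (m \x mu) (@tuple_cons n).

HB.instance Definition _ := Measure.copy tuple_measureS
  (measure_function_pushforward__canonical__measure_function_Measure
    (m \x mu) (@measurable_tuple_cons n)).

Let sigma_finite_tuple_measureS : sigma_finite setT tuple_measureS.
Proof.
have /sigma_finiteP[F [TF ndF Foo]] := sigma_finiteT m.
have /sigma_finiteP[G [TG ndG Goo]] := sigma_finiteT mu.
pose uncons (t : n.+1.-tuple T) := (thead t, [tuple of behead t]).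
have unconsK p : uncons (tuple_cons p) = p.
  by case: p => x t; rewrite /uncons/= theadE; congr pair; apply/val_inj.
have muncons : measurable_fun setT uncons.
  apply/measurable_fun_pairP; split.
    exact: (measurable_tnth ord0).
  exact: measurable_behead.
exists (fun i => uncons @^-1` (F i `*` G i)).
  rewrite -preimage_bigcup; apply/esym; rewrite -subTset => t _ /=.
  have [i _ Fi] : (\bigcup_i F i) (uncons t).1 by rewrite -TF.
  have [j _ Gj] : (\bigcup_i G i) (uncons t).2 by rewrite -TG.
  exists (maxn i j) => //; split.
    by move: Fi; exact/subsetPset/ndF/leq_maxl.
  by move: Gj; exact/subsetPset/ndG/leq_maxr.
move=> i; have [mF Fi] := Foo i; have [mG Gi] := Goo i; split.
  by rewrite -[X in measurable X]setTI; apply: muncons => //; exact: measurableX.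
rewrite /tuple_measureS /pushforward -comp_preimage.
rewrite (_ : uncons \o _ = id) ?preimage_id; last exact/funext.
by rewrite product_measure1E// lte_mul_pinfty// ge0_fin_numE.
Qed.

HB.instance Definition _ := Measure_isSigmaFinite.Build _ _ _ tuple_measureS
  sigma_finite_tuple_measureS.

End step.

Fixpoint tuple_measure n : {sigma_finite_measure set (n.-tuple T) -> \bar R} :=
  match n with
  | 0 => dirac [tuple]
  | k.+1 => tuple_measureS (tuple_measure k)
  end.

End tuple_measure.

(* Makes the library's Landau notation available at +oo. *)
Canonical pinfty_filter_on (R : numFieldType) := FilterType (pinfty_nbhs R) _.

(* Calculus on [0, +oo[ for functions R -> R whose values at negative reals are
   irrelevant: difference quotients at y only use points of [0, +oo[, so that
   derivatives at 0 are right derivatives. *)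
Section halfline.
Variable R : realType.
Implicit Types (f : R -> R) (y : R).

Definition dquot f y (h : R) : R := h^-1 * (f (y + h) - f y).

Definition increments y : set_system R := within [set h | 0 <= y + h] 0^'.

Definition derivable_hl f y : Prop := cvg (dquot f y @ increments y).

Definition derive_hl f y : R := lim (dquot f y @ increments y).

Definition C3_hl f : Prop :=
  (forall k, (k < 3)%N ->
    forall y, 0 <= y -> derivable_hl (iter k derive_hl f) y) /\
  {within `[0, +oo[, continuous (iter 3 derive_hl f)}.

Definition admissible_weight (n : nat) (psi : R -> R) : Prop :=
  [/\ forall y, 0 <= y -> 0 <= psi y,
      C3_hl psi,
      forall y, 0 <= y ->
        [/\ 0 < derive_hl psi y,
            0 <= iter 2 derive_hl psi y &
            0 <= iter 3 derive_hl psi y] &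
      exists2 l : R, l < 2^-1 &
        let phi := fun y => y * derive_hl psi y in
        iter 2 derive_hl phi =O_ +oo
          (fun y => y `^ (- 2^-1) * derive_hl phi y `^ (1 + l)) /\
        ((1 < n)%N ->
          iter 2 derive_hl psi =O_ +oo
            (fun y => y `^ (- 2^-1) * derive_hl psi y `^ (1 + l)))].

End halfline.

Section euclidean.
Variables (R : realType) (n : nat).

Definition hdot (w z : 'cV[R[i]]_n) : R[i] := \sum_j w j 0 * (z j 0)^*.

Definition hnorm (w : 'cV[R[i]]_n) : R := Num.sqrt (complex.Re (hdot w w)).

Definition opnorm (C : 'M[R[i]]_n) : R :=
  sup [set hnorm (C *m z) | z in [set z | hnorm z <= 1]].

(* C^n as R^(n + n): real parts first, then imaginary parts. *)
Definition Cvec (t : (n + n).-tuple R) : 'cV[R[i]]_n :=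
  \col_j (tnth t (lshift n j) +i* tnth t (rshift n j))%C.

Definition lebesgue_Cn := tuple_measure (@lebesgue_measure R) (n + n).

(* Differentiability over the scalar field R[i]. *)
Definition holomorphic (g : 'cV[R[i]]_n -> R[i]) : Prop :=
  forall z, differentiable (g : _ -> R[i]^o) z.

End euclidean.

(* Operators on a subspace H, with inner product ip, of a complex vector
   space V; they are given by maps V -> V whose values outside H are
   irrelevant. *)
Section operators.
Variables (R : realType) (V : lmodType R[i]).
Variables (H : set V) (ip : V -> V -> R[i]).
Implicit Types S T : V -> V.

Definition ipnorm (f : V) : R := Num.sqrt (complex.Re (ip f f)).

Definition bounded_operator S : Prop :=
  [/\ forall f, H f -> H (S f),
      forall (a : R[i]) f g, H f -> H g -> S (a *: f + g) = a *: S f + S g &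
      exists M : R, forall f, H f -> ipnorm (S f) <= M * ipnorm f].

Definition is_adjoint S T : Prop :=
  bounded_operator T /\ forall f g, H f -> H g -> ip (S f) g = ip f (T g).

Definition isometry_on T : Prop := forall f, H f -> ipnorm (T f) = ipnorm f.

Definition coisometry S : Prop := exists2 T, is_adjoint S T & isometry_on T.

End operators.

Section fock.
Variables (R : realType) (n : nat) (psi : R -> R).
Implicit Types g h : 'cV[R[i]]_n -> R[i].

Definition weight (z : 'cV[R[i]]_n) : R := expR (- psi (hnorm z ^+ 2)).

Definition fock : set ('cV[R[i]]_n -> R[i]) :=
  [set g | holomorphic g /\
    (\int[@lebesgue_Cn R n]_t
      (complex.Re `|g (Cvec t)| ^+ 2 * weight (Cvec t))%:E < +oo)%E].

Definition fock_ip g h : R[i] :=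
  let F t := g (Cvec t) * (h (Cvec t))^* in
  (\int[@lebesgue_Cn R n]_t (complex.Re (F t) * weight (Cvec t)) +i*
   \int[@lebesgue_Cn R n]_t (complex.Im (F t) * weight (Cvec t)))%C.

Definition comp_op (Gamma : 'cV[R[i]]_n -> 'cV[R[i]]_n) g :
  'cV[R[i]]_n -> R[i] := g \o Gamma.

End fock.

(* Main.v *)
Require Import Defs.
From mathcomp Require Import all_boot all_order fingroup perm all_algebra.
From mathcomp Require Import complex ring lra.
From mathcomp Require Import all_classical all_reals all_analysis.
From mathcomp Require Import measurable_realfun.

Import Order.TTheory GRing.Theory Num.Theory.
Import numFieldNormedType.Exports.

Set Implicit Arguments.
Unset Strict Implicit.
Unset Printing Implicit Defensive.

Local Open Scope classical_set_scope.
Local Open Scope ring_scope.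

(** Write S for the composition operator of Gamma(z) = C z - D, and let T be
an isometric adjoint of S.

From co-isometry to unitarity. Since <S T g, h> = <T g, T h> = <g, h>, the
operator T is a right inverse of S ([coisometry_right_inverse]), so S is onto.
The coordinate functions z_j belong to the Fock space and are therefore of the
form f o Gamma; this forces C to be injective, hence invertible
([comp_op_surjective_unitmx]). Then Gamma is onto, S is injective, T is a
two-sided inverse of S, and S preserves the inner product
([coisometry_affine_isometry]). It is enough to use this on the constant 1 and
on the coordinates. The coordinates are orthogonal to 1 and to each other, and
they all have the same norm ([fock_ip_coordf_one], [fock_ip_coordf_neq],
[fock_ip_coordf_eq]). Now
S 1 = 1 and S z_j = sum_k C_jk z_k - D_j, so
0 = <z_j, 1> = <S z_j, S 1> = - D_j |1|^2 gives D = 0, and then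
delta_ij |z_1|^2 = <S z_i, S z_j> = (C C^* )_ij |z_1|^2 says that C is unitary.

From unitarity to co-isometry. Lebesgue measure and the weight are invariant
under a unitary matrix, so the composition operator of C^-1 is an isometric
adjoint of S ([unitary_coisometry]).

Both directions use that Lebesgue measure on C^n, an iterated product of
one-dimensional Lebesgue measures, is invariant under unitary matrices; the
orthogonality relations come from this invariance applied to diagonal sign
matrices and to permutation matrices. The invariance is the classical
uniqueness argument for translation invariant measures, by Tonelli's theorem
([ge0_integral_unitary]).

That 1 and z_j are square integrable for the weight comes from the convexity
of psi: it grows at least linearly ([admissible_weight_lower]), so that the
weight is dominated by a Gaussian. *)

(** * Integration on products of copies of a measure space *)

Section tuple_measure_theory.
Local Open Scope ereal_scope.
Context d (T : measurableType d) (R : realType).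
Variable m : {sigma_finite_measure set T -> \bar R}.

Lemma ge0_integral_tuple_measureS n (f : n.+1.-tuple T -> \bar R) :
  measurable_fun setT f -> (forall t, 0 <= f t) ->
  \int[tuple_measure m n.+1]_t f t =
  \int[m]_x \int[tuple_measure m n]_t f [tuple of x :: t].
Proof.
move=> mf f0.
have mc := @measurable_tuple_cons _ T n.
rewrite [LHS](@ge0_integral_pushforward _ _ _ _ _ (@tuple_cons _ T n) mc
  (m \x tuple_measure m n) setT f)//.
rewrite preimage_setT fubini_tonelli1//.
  exact: measurableT_comp.
by move=> x; exact: f0.
Qed.

Lemma measurable_fun_prod_tnth n (F : T -> R) : measurable_fun setT F ->
  measurable_fun setT (fun t : n.-tuple T => (\prod_(i < n) F (tnth t i))%R).
Proof.
move=> mF; apply: measurable_prod => i _.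
apply: (measurableT_comp mF); exact: measurable_tnth.
Qed.

Lemma integral_prod_tnth n (F : T -> R) (a : R) :
  measurable_fun setT F -> (forall x, 0 <= F x)%R ->
  \int[m]_x (F x)%:E = a%:E ->
  \int[tuple_measure m n]_t (\prod_(i < n) F (tnth t i))%:E = (a ^+ n)%:E.
Proof.
move=> mF F0 intF; elim: n => [|n IHn].
  rewrite [LHS]integral_dirac//.
    by rewrite diracT mul1e big_ord0 expr0.
  by apply/measurable_EFinP; apply: measurable_fun_prod_tnth.
rewrite ge0_integral_tuple_measureS//=; last 2 first.
- by apply/measurable_EFinP; apply: (@measurable_fun_prod_tnth n.+1).
- by move=> t; rewrite lee_fin; apply: prodr_ge0.
transitivity (\int[m]_x ((F x)%:E * (a ^+ n)%:E)).
  apply: eq_integral => x _; rewrite -IHn -ge0_integralZl//.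
  - apply: eq_integral => t _; rewrite big_ord_recl/= -EFinM.
    congr ((F _ * _)%:E); apply: eq_bigr => i _.
    by rewrite tnthS.
  - by apply/measurable_EFinP; apply: measurable_fun_prod_tnth.
  - by move=> t _; rewrite lee_fin; apply: prodr_ge0.
  - by rewrite lee_fin.
rewrite ge0_integralZr//=; last 3 first.
- exact/measurable_EFinP.
- by move=> x _; rewrite lee_fin.
- rewrite lee_fin exprn_ge0// -lee_fin -intF; apply: integral_ge0 => x _.
  by rewrite lee_fin.
by rewrite intF -EFinM exprS.
Qed.

Definition tuple_box n (A : 'I_n -> set T) : set (n.-tuple T) :=
  [set t | forall i, A i (tnth t i)].

Lemma measurable_tuple_box n (A : 'I_n -> set T) :
  (forall i, measurable (A i)) -> measurable (tuple_box A).
Proof.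
move=> mA.
have -> : tuple_box A = \bigcap_(i in setT) ((@tnth n T)^~ i @^-1` A i).
  by apply/seteqP; split => t /= At i; [move=> _|]; exact: At.
apply: fin_bigcap_measurable => // i _.
rewrite -[X in measurable X]setTI; apply: measurable_tnth => //.
Qed.

Lemma tuple_measure_box_gt0 n (A : 'I_n -> set T) :
  (forall i, measurable (A i)) -> (forall i, 0 < m (A i)) ->
  0 < tuple_measure m n (tuple_box A).
Proof.
elim: n A => [|n IHn] A mA A0.
  rewrite /= /dirac/= indicE mem_set ?lte01// => -[]//.
have -> : tuple_measure m n.+1 (tuple_box A) =
    (m \x tuple_measure m n) (A ord0 `*` tuple_box (A \o lift ord0)).
  congr ((m \x tuple_measure m n) _); apply/seteqP; split=> [[x t] /= xt|].
    split => [|i] /=; first by have := xt ord0.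
    have := xt (lift ord0 i); rewrite tnthS => h; exact: h.
  move=> [x t] [/= Ax At] i; rewrite /tuple_cons/=.
  case: (unliftP ord0 i) => [j ->|->]; last by [].
  by rewrite tnthS; exact: At.
have mB : measurable (tuple_box (A \o lift ord0)).
  by apply: measurable_tuple_box => i; exact: mA.
rewrite product_measure1E//.
apply: mule_gt0; first exact: A0.
by apply: IHn => i /=; [exact: mA|exact: A0].
Qed.

Definition tuple_map n (phi : 'I_n -> T -> T) (t : n.-tuple T) : n.-tuple T :=
  [tuple phi i (tnth t i) | i < n].

Lemma measurable_tuple_map n (phi : 'I_n -> T -> T) :
  (forall i, measurable_fun setT (phi i)) ->
  measurable_fun setT (tuple_map phi).
Proof.
move=> mphi; apply/measurable_fun_tnthP => i.
rewrite [X in measurable_fun _ X](_ : _ = phi i \o (@tnth n T)^~ i).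
  by apply: measurableT_comp => //; exact: measurable_tnth.
by apply/funext => t /=; rewrite tnth_mktuple.
Qed.

(** Applying measure preserving maps coordinatewise preserves the product
measure; translations of R^n are the case of interest. *)
Lemma ge0_integral_tuple_map n (phi : 'I_n -> T -> T)
    (f : n.-tuple T -> \bar R) :
  (forall i, measurable_fun setT (phi i)) ->
  (forall i A, measurable A -> m (phi i @^-1` A) = m A) ->
  measurable_fun setT f -> (forall t, 0 <= f t) ->
  \int[tuple_measure m n]_t f (tuple_map phi t) =
  \int[tuple_measure m n]_t f t.
Proof.
elim: n phi f => [|n IHn] phi f mphi phiE mf f0.
  by apply: eq_integral => t _; rewrite (tuple0 t) (tuple0 (tuple_map _ _)).
rewrite !ge0_integral_tuple_measureS//; last first.
  by apply: measurableT_comp => //; exact: measurable_tuple_map.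
have fcons (x : T) (t : n.-tuple T) : f (tuple_map phi [tuple of x :: t]) =
    f [tuple of phi ord0 x :: tuple_map (phi \o lift ord0) t].
  congr f; apply: eq_from_tnth => i; rewrite tnth_mktuple.
  case: (unliftP ord0 i) => [j ->|->]; last by [].
  by rewrite !tnthS tnth_mktuple.
have mcons (x : T) :
    measurable_fun setT (fun t : n.-tuple T => [tuple of x :: t]).
  by apply: measurable_cons.
under eq_integral => x _.
  under eq_integral => t _ do rewrite fcons.
  rewrite (IHn _ (fun t => f [tuple of phi ord0 x :: t]))//; first over.
  - by move=> i /=; exact: mphi.
  - by move=> i A /=; exact: phiE.
  - exact: measurableT_comp.
pose g (x : T) := \int[tuple_measure m n]_t f [tuple of x :: t].
have mg : measurable_fun setT g.
  apply: (@measurable_fun_fubini_tonelli_F _ _ _ _ _ _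
    (f \o @tuple_cons _ T n)).
    by apply: measurableT_comp => //; exact: measurable_tuple_cons.
  by move=> x; exact: f0.
have g0 x : 0 <= g x by apply: integral_ge0.
transitivity (\int[pushforward m (phi ord0)]_x g x).
  by rewrite ge0_integral_pushforward.
by apply: eq_measure_integral => A mA _; exact: phiE.
Qed.

End tuple_measure_theory.

(** * Complex-valued measurable functions *)

Section complex_measurable.
Context d (T : measurableType d) (R : realType).
Implicit Types f g : T -> R[i].

Definition cmeasurable f :=
  measurable_fun setT (fun x => complex.Re (f x)) /\
  measurable_fun setT (fun x => complex.Im (f x)).

Lemma cmeasurable_cst (c : R[i]) : cmeasurable (fun=> c).
Proof. by split; exact: measurable_cst. Qed.

Lemma cmeasurableD f g :
  cmeasurable f -> cmeasurable g -> cmeasurable (fun x => f x + g x).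
Proof.
move=> [rf jf] [rg jg]; split.
  under eq_fun do rewrite raddfD.
  exact: measurable_funD.
under eq_fun do rewrite raddfD.
exact: measurable_funD.
Qed.

Lemma complex_ReM (x y : R[i]) : complex.Re (x * y) =
  complex.Re x * complex.Re y - complex.Im x * complex.Im y.
Proof. by case: x; case: y. Qed.

Lemma complex_ImM (x y : R[i]) : complex.Im (x * y) =
  complex.Re x * complex.Im y + complex.Im x * complex.Re y.
Proof. by case: x; case: y. Qed.

Lemma complex_ReJ (x : R[i]) : complex.Re x^* = complex.Re x.
Proof. by case: x. Qed.

Lemma complex_ImJ (x : R[i]) : complex.Im x^* = - complex.Im x.
Proof. by case: x. Qed.

Lemma cmeasurableM f g :
  cmeasurable f -> cmeasurable g -> cmeasurable (fun x => f x * g x).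
Proof.
move=> [rf jf] [rg jg]; split.
  under eq_fun do rewrite complex_ReM.
  by apply: measurable_funB; exact: measurable_funM.
under eq_fun do rewrite complex_ImM.
by apply: measurable_funD; exact: measurable_funM.
Qed.

Lemma cmeasurableJ f : cmeasurable f -> cmeasurable (fun x => (f x)^*).
Proof.
move=> [rf jf]; split.
  by under eq_fun do rewrite complex_ReJ.
under eq_fun do rewrite complex_ImJ.
exact: measurableT_comp.
Qed.

Lemma cmeasurable_sum (I : Type) (r : seq I) (F : I -> T -> R[i]) :
  (forall i, cmeasurable (F i)) -> cmeasurable (fun x => \sum_(i <- r) F i x).
Proof.
move=> mF; elim: r => [|i r IHr].
  under eq_fun do rewrite big_nil.
  exact: cmeasurable_cst.
under eq_fun do rewrite big_cons.
exact: cmeasurableD.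
Qed.

Definition cvmeasurable n (p : T -> 'cV[R[i]]_n) :=
  forall j, cmeasurable (fun x => p x j 0).

Lemma cvmeasurableD n (p q : T -> 'cV[R[i]]_n) :
  cvmeasurable p -> cvmeasurable q -> cvmeasurable (fun x => p x + q x).
Proof.
move=> mp mq j; under eq_fun do rewrite mxE.
exact: cmeasurableD.
Qed.

Lemma cvmeasurable_mulmx n m (U : 'M[R[i]]_(m, n)) (p : T -> 'cV[R[i]]_n) :
  cvmeasurable p -> cvmeasurable (fun x => U *m p x).
Proof.
move=> mp j; under eq_fun do rewrite mxE.
by apply: cmeasurable_sum => i; apply: cmeasurableM.
Qed.

End complex_measurable.

(** * Lebesgue measure on complex coordinate space *)

Section lebesgue_Cn_theory.
Context {R : realType} {n : nat}.
Local Notation mu := (@lebesgue_Cn R n).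
Local Notation Cn := 'cV[R[i]]_n.
Implicit Types (z a : Cn) (t : (n + n).-tuple R) (U : 'M[R[i]]_n).

Definition tuple_of_Cvec z : (n + n).-tuple R :=
  [tuple match fintype.split i with
         | inl j => complex.Re (z j 0)
         | inr j => complex.Im (z j 0)
         end | i < n + n].

Lemma tuple_of_CvecK : cancel tuple_of_Cvec (@Cvec R n).
Proof.
move=> z; apply/colP => j; rewrite mxE !tnth_mktuple.
rewrite (unsplitK (inl j)) (unsplitK (inr j)).
by case: (z j 0).
Qed.

Lemma cvmeasurable_Cvec : cvmeasurable (@Cvec R n).
Proof.
by move=> j; split; under eq_fun do rewrite mxE; exact: measurable_tnth.
Qed.

(** Measurability of functions on C^n is always expressed after composition
with [Cvec]; this is the rule for composing with a map into C^n. *)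
Lemma measurable_comp_Cvec d (T : measurableType d) d' (T' : measurableType d')
    (F : Cn -> T') (p : T -> Cn) :
  measurable_fun setT (F \o @Cvec R n) -> cvmeasurable p ->
  measurable_fun setT (F \o p).
Proof.
move=> mF mp.
have -> : F \o p = (F \o @Cvec R n) \o (tuple_of_Cvec \o p).
  by apply/funext => x /=; rewrite tuple_of_CvecK.
apply: measurableT_comp => //; apply/measurable_fun_tnthP => i /=.
rewrite [X in measurable_fun _ X](_ : _ = fun x => match fintype.split i with
         | inl j => complex.Re (p x j 0)
         | inr j => complex.Im (p x j 0) end).
  by case: (fintype.split i) => j; have [] := mp j.
by apply/funext => x /=; rewrite tnth_mktuple.
Qed.

Lemma Re_hdot_Cvec t :
  complex.Re (hdot (Cvec t) (Cvec t)) = \sum_(i < n + n) tnth t i ^+ 2.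
Proof.
rewrite big_split_ord /hdot raddf_sum/= -big_split/=; apply: eq_bigr => j _ /=.
by rewrite !mxE complex_ReM complex_ReJ complex_ImJ/= mulrN opprK !expr2.
Qed.

Lemma hdot_trmxC (w z : Cn) : hdot w z = ((map_mx Num.conj z)^T *m w) 0 0.
Proof. by rewrite mxE; apply: eq_bigr => j _; rewrite !mxE mulrC. Qed.

Lemma hdot_unitary U (w z : Cn) : U \is unitarymx ->
  hdot (U *m w) (U *m z) = hdot w z.
Proof.
move=> UU; rewrite !hdot_trmxC map_mxM trmx_mul -mulmxA.
have UV : (map_mx Num.conj U)^T = invmx U by rewrite invmx_unitary// map_trmx.
by rewrite UV mulKmx// unitarymx_unit.
Qed.

Lemma hnorm_unitary U z : U \is unitarymx -> hnorm (U *m z) = hnorm z.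
Proof. by move=> UU; rewrite /hnorm hdot_unitary. Qed.

Lemma hnorm_sqr_Cvec t : hnorm (Cvec t) ^+ 2 = \sum_(i < n + n) tnth t i ^+ 2.
Proof.
rewrite /hnorm sqr_sqrtr Re_hdot_Cvec//.
by apply: sumr_ge0 => i _; exact: sqr_ge0.
Qed.

Lemma hnormN z : hnorm (- z) = hnorm z.
Proof.
rewrite /hnorm /hdot; congr (Num.sqrt (complex.Re _)).
by apply: eq_bigr => j _; rewrite !mxE rmorphN mulrNN.
Qed.

Lemma lebesgue_measure_shift (c : R) (A : set (measurableTypeR R)) :
  measurable A -> lebesgue_measure ((fun x => x + c) @^-1` A) =
                  lebesgue_measure A.
Proof.
have mshift : measurable_fun [set: measurableTypeR R]
    (fun x : measurableTypeR R => x + c : measurableTypeR R).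
  by apply: measurable_funD => //; exact: measurable_cst.
move=> mA; apply/esym.
apply: (lebesgue_measure_unique (mu := pushforward lebesgue_measure
  (fun x : measurableTypeR R => x + c : measurableTypeR R))) => //.
move=> _ [[a b]] _ <-.
rewrite /pushforward.
rewrite [X in _ = lebesgue_measure X](_ : _ = `](a - c), (b - c)]%classic).
  2: by apply/seteqP; split => x /=; rewrite !in_itv/= ltrBlDr lerBrDr.
rewrite !lebesgue_measure_itv/= !lte_fin ltrD2r.
by case: ifP => // _; rewrite -!EFinB; congr _%:E; lra.
Qed.

Lemma ge0_integral_shift (a : Cn) (F : Cn -> \bar R) :
  measurable_fun setT (F \o @Cvec R n) -> (forall z, 0 <= F z)%E ->
  (\int[mu]_t F (Cvec t + a)%R = \int[mu]_t F (Cvec t))%E.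
Proof.
move=> mF F0.
pose s i (x : measurableTypeR R) : measurableTypeR R :=
  x + tnth (tuple_of_Cvec a) i.
rewrite -(@ge0_integral_tuple_map _ (measurableTypeR R) R lebesgue_measure _ s
  (F \o @Cvec R n))//.
- apply: eq_integral => t _ /=; congr F; apply/colP => j.
  rewrite !mxE /tuple_map !tnth_mktuple /s !tnth_mktuple.
  rewrite (unsplitK (inl j)) (unsplitK (inr j)).
  by case: (a j 0).
- by move=> i; apply: measurable_funD => //; exact: measurable_cst.
- by move=> i A mA; exact: lebesgue_measure_shift.
- by move=> t; exact: F0.
Qed.

Let gauss z : R := expR (- hnorm z ^+ 2).

Let gauss_Cvec t : gauss (Cvec t) = \prod_(i < n + n) gauss_fun (tnth t i).
Proof. by rewrite /gauss hnorm_sqr_Cvec -sumrN expR_sum. Qed.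

Let measurable_gauss : measurable_fun setT (gauss \o @Cvec R n).
Proof.
rewrite (_ : _ \o _ = fun t => \prod_(i < n + n) gauss_fun (tnth t i)).
  apply: (@measurable_fun_prod_tnth _ (measurableTypeR R) R).
  exact: measurable_gauss_fun.
by apply/funext => t /=; rewrite gauss_Cvec.
Qed.

Let integral_gauss :
  (\int[mu]_t (gauss (Cvec t))%:E = (Num.sqrt pi ^+ (n + n))%:E)%E.
Proof.
under eq_integral do rewrite gauss_Cvec.
apply: (@integral_prod_tnth _ (measurableTypeR R) R lebesgue_measure).
- exact: measurable_gauss_fun.
- exact: gauss_fun_ge0.
- exact: integralT_gauss.
Qed.

(** Uniqueness of the translation invariant measure: let G be a Gaussian, which
is even and invariant under U. By Tonelli's theorem and two translations,
  (int F) (int G) = int_y int_x F (x + U y) G y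
                  = int_x int_y F (U y) G (y - U^-1 x)
                  = int_y F (U y) int_x G (x - U y) = (int F o U) (int G),
and int G is finite and positive. *)
Lemma ge0_integral_unitary U (F : Cn -> \bar R) : U \is unitarymx ->
  measurable_fun setT (F \o @Cvec R n) -> (forall z, 0 <= F z)%E ->
  (\int[mu]_t F (U *m Cvec t) = \int[mu]_t F (Cvec t))%E.
Proof.
move=> UU mF F0.
pose g : R := Num.sqrt pi ^+ (n + n).
have g0 : 0 < g by rewrite exprn_gt0// sqrtr_gt0 pi_gt0.
pose G z := (gauss z)%:E.
have G0 z : (0 <= G z)%E by rewrite lee_fin expR_ge0.
have mG : measurable_fun setT (G \o @Cvec R n) by exact/measurable_EFinP.
have GU z : G (U *m z) = G z by rewrite /G /gauss hnorm_unitary.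
have GN z : G (- z) = G z by rewrite /G /gauss hnormN.
have intG : (\int[mu]_t G (Cvec t) = g%:E)%E by exact: integral_gauss.
have mC := cvmeasurable_Cvec.
pose V := invmx U.
have UV : U *m V = 1%:M by rewrite mulmxV// unitarymx_unit.
have mfst : cvmeasurable (fun x : (n + n).-tuple R * (n + n).-tuple R =>
    Cvec x.1 : Cn).
  move=> j; have [r i] := mC j.
  by split; [apply: (measurableT_comp r)|apply: (measurableT_comp i)].
have msnd : cvmeasurable (fun x : (n + n).-tuple R * (n + n).-tuple R =>
    Cvec x.2 : Cn).
  move=> j; have [r i] := mC j.
  by split; [apply: (measurableT_comp r)|apply: (measurableT_comp i)].
have mFU : measurable_fun setT (fun t => F (U *m Cvec t)).
  by apply: (measurable_comp_Cvec (F := F)) => //; exact: cvmeasurable_mulmx.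
have swap (H : (n + n).-tuple R -> (n + n).-tuple R -> \bar R) :
    measurable_fun setT (fun xy => H xy.1 xy.2) ->
    (forall x y, 0 <= H x y)%E ->
    (\int[mu]_x \int[mu]_y H x y = \int[mu]_y \int[mu]_x H x y)%E.
  move=> mH H0; pose f xy := H xy.1 xy.2.
  by apply: (fubini_tonelli (m1 := mu) (m2 := mu) f) => // xy; exact: H0.
have key : (\int[mu]_t F (Cvec t) * g%:E = \int[mu]_t F (U *m Cvec t) * g%:E)%E.
  transitivity (\int[mu]_y \int[mu]_x
      (F (Cvec x + U *m Cvec y)%R * G (Cvec y)))%E.
    rewrite -intG muleC -ge0_integralZr//; last exact: integral_ge0.
    apply: eq_integral => y _; rewrite muleC ge0_integralZr//; last first.
      by apply: (measurable_comp_Cvec (F := F)) => //; apply: cvmeasurableD.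
    by rewrite ge0_integral_shift.
  transitivity (\int[mu]_x \int[mu]_y
      (F (U *m Cvec y) * G (Cvec y - V *m Cvec x)%R))%E.
    transitivity (\int[mu]_x \int[mu]_y
        (F (Cvec x + U *m Cvec y)%R * G (Cvec y)))%E.
      apply: (swap (fun y x => F (Cvec x + U *m Cvec y)%R * G (Cvec y))%E).
      - apply: emeasurable_funM; last exact: (measurable_comp_Cvec (F := G)).
        apply: (measurable_comp_Cvec (F := F)) => //.
        by apply: cvmeasurableD => //; exact: cvmeasurable_mulmx.
      - by move=> x y; rewrite mule_ge0.
    apply: eq_integral => x _ /=.
    rewrite -(ge0_integral_shift (- (V *m Cvec x))
      (F := fun y => F (Cvec x + U *m y)%R * G y)%E); last 2 first.
      - apply: emeasurable_funM => //.
        apply: (measurable_comp_Cvec (F := F)) => //.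
        apply: cvmeasurableD => //.
        exact: cvmeasurable_mulmx.
      - by move=> z; rewrite mule_ge0.
    apply: eq_integral => y _; congr (F _ * _)%E.
    by rewrite mulmxBr mulmxA UV mul1mx addrC subrK.
  transitivity (\int[mu]_y \int[mu]_x
      (F (U *m Cvec y) * G (Cvec y - V *m Cvec x)%R))%E.
    apply: (swap (fun x y => F (U *m Cvec y) * G (Cvec y - V *m Cvec x)%R)%E).
    - apply: emeasurable_funM.
        apply: (measurable_comp_Cvec (F := F)) => //.
        exact: cvmeasurable_mulmx.
      apply: (measurable_comp_Cvec (F := G)) => //.
      apply: cvmeasurableD => //.
      under eq_fun do rewrite -mulNmx; exact: cvmeasurable_mulmx.
    - by move=> x y; rewrite mule_ge0.
  rewrite -ge0_integralZr//; last by rewrite lee_fin ltW.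
  apply: eq_integral => y _ /=; rewrite ge0_integralZl//; last first.
    - apply: (measurable_comp_Cvec (F := G)) => //; apply: cvmeasurableD => //.
      under eq_fun do rewrite -mulNmx; exact: cvmeasurable_mulmx.
  congr (F (U *m Cvec y) * _)%E.
  transitivity (\int[mu]_x G (Cvec x - U *m Cvec y)%R)%E.
    apply: eq_integral => x _.
    by rewrite -GU mulmxBr mulmxA UV mul1mx -GN opprB.
  by rewrite ge0_integral_shift.
have gpos : (0 < g%:E)%E by rewrite lte_fin.
have gfin : g%:E \is a fin_num by [].
apply/eqP; rewrite eq_le; apply/andP.
by split; rewrite -(lee_pmul2r gfin gpos) key.
Qed.

End lebesgue_Cn_theory.

(** * Continuous functions on complex coordinate space *)

Section continuous_Cn.
Context {R : realType} {n : nat}.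
Local Notation mu := (@lebesgue_Cn R n).
Local Notation Cn := 'cV[R[i]^o]_n.

Lemma normc_ge_Im (x : R[i]) : (`|complex.Im x|%:C)%C <= `|x|.
Proof.
rewrite normc_def lecR -(sqrtr_sqr (complex.Im x)) ler_wsqrtr//.
by rewrite lerDr sqr_ge0.
Qed.

Lemma continuous_Re : continuous (@complex.Re R : R[i]^o -> R).
Proof.
move=> x A /nbhs_ballP[e /= e0 eA]; apply/nbhs_ballP.
exists (e%:C)%C => /=; first by rewrite ltcR.
move=> y xy; apply: eA; move: xy; rewrite /ball/= -raddfB -ltcR.
by apply: le_lt_trans; exact: normc_ge_Re.
Qed.

Lemma continuous_Im : continuous (@complex.Im R : R[i]^o -> R).
Proof.
move=> x A /nbhs_ballP[e /= e0 eA]; apply/nbhs_ballP.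
exists (e%:C)%C => /=; first by rewrite ltcR.
move=> y xy; apply: eA; move: xy; rewrite /ball/= -raddfB -ltcR.
by apply: le_lt_trans; exact: normc_ge_Im.
Qed.

(** The topology of R[i] is given by balls whose radii are complex numbers,
necessarily real and positive; small squares form an equivalent system. *)
Lemma nbhs_complex (z : R[i]^o) (P : set R[i]^o) : nbhs z P ->
  exists2 e : R, 0 < e & forall w, `|complex.Re (w - z)| < e ->
    `|complex.Im (w - z)| < e -> P w.
Proof.
move=> /nbhs_ballP[e /=]; rewrite ltcE => /andP[/eqP/= e0 eP] zP.
exists (complex.Re e / 2); first by rewrite divr_gt0.
move=> w wr wi; apply: zP; rewrite /ball/= distrC normc_def ltcE e0/= eqxx/=.
rewrite -(ger0_norm (ltW eP)) -(sqrtr_sqr (complex.Re e)) ltr_sqrt ?exprn_gt0//.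
move: wr wi; rewrite !ltr_norml.
set a := complex.Re (w - z); set b := complex.Im (w - z).
move=> /andP[a1 a2] /andP[b1 b2]; nra.
Qed.

Definition ratbox (pq : (n + n).-tuple (rat * rat)) : set ((n + n).-tuple R) :=
  @tuple_box _ (measurableTypeR R) _
    (fun i => `](ratr (tnth pq i).1 : R), ratr (tnth pq i).2[%classic).

Lemma measurable_ratbox pq :
  measurable (ratbox pq : set ((n + n).-tuple (measurableTypeR R))).
Proof.
apply: (@measurable_tuple_box _ (measurableTypeR R)) => i.
exact: measurable_itv.
Qed.

(** The sigma-algebra on tuples is the product one, so open sets are shown to be
measurable by covering them with countably many rational boxes. *)
Lemma open_ratbox (A : set Cn) (t : (n + n).-tuple R) : open A -> A (Cvec t) ->
  exists2 pq, ratbox pq t & ratbox pq `<=` @Cvec R n @^-1` A.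
Proof.
move=> oA At; have [P zP PA] : nbhs (Cvec t : Cn) A by exact: open_nbhs_nbhs.
have /choice[e eP] : forall j : 'I_n, exists e : R, 0 < e /\
    forall w, `|complex.Re (w - Cvec t j 0)| < e ->
    `|complex.Im (w - Cvec t j 0)| < e -> P j 0 w.
  by move=> j; have [e e0 eP] := nbhs_complex (zP j 0); exists e.
pose e' (i : 'I_(n + n)) : R :=
  e (match fintype.split i with inl j => j | inr j => j end).
have e'0 i : 0 < e' i by exact: (eP _).1.
have /choice[pq pqP] : forall i, exists pq : rat * rat,
    [/\ tnth t i - e' i < ratr pq.1, ratr pq.1 < tnth t i,
        tnth t i < ratr pq.2 & ratr pq.2 < tnth t i + e' i].
  move=> i; have /rat_in_itvoo[p] : tnth t i - e' i < tnth t i.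
    by rewrite ltrBlDr ltrDl.
  rewrite in_itv/= => /andP[p1 p2].
  have /rat_in_itvoo[q] : tnth t i < tnth t i + e' i by rewrite ltrDl.
  by rewrite in_itv/= => /andP[q1 q2]; exists (p, q).
exists [tuple pq i | i < n + n].
  by move=> i; rewrite tnth_mktuple/= in_itv/=; have [_ -> -> _] := pqP i.
move=> s sB /=; apply: PA => j k; rewrite (ord1 k).
have near_t i : `|tnth s i - tnth t i| < e' i.
  have := sB i; rewrite tnth_mktuple/= in_itv/= => /andP[s1 s2].
  have [p1 _ _ p2] := pqP i; rewrite ltr_norml; apply/andP; split; lra.
apply: (eP j).2; rewrite !mxE/=.
  by have := near_t (lshift n j); rewrite /e' (unsplitK (inl j)).
by have := near_t (rshift n j); rewrite /e' (unsplitK (inr j)).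
Qed.

Lemma measurable_Cvec_open (A : set Cn) : open A ->
  measurable (@Cvec R n @^-1` A : set ((n + n).-tuple (measurableTypeR R))).
Proof.
move=> oA; pose D := [set pq | ratbox pq `<=` @Cvec R n @^-1` A].
have -> : @Cvec R n @^-1` A =
    \bigcup_pq (if `[< D pq >] then ratbox pq else set0).
  apply/seteqP; split => [t At|t [pq _]].
    have [pq tpq pqA] := open_ratbox oA At.
    by exists pq => //; case: asboolP.
  by case: asboolP => // Dpq; exact: Dpq.
apply: countable_bigcupT_measurable => [|pq]; first exact: countableP.
by case: asboolP => // _; exact: measurable_ratbox.
Qed.

Lemma continuous_measurable_Cvec (g : Cn -> R) : continuous g ->
  measurable_fun setT (g \o @Cvec R n).
Proof.
move=> /continuousP cg; apply: (measurability _ (RGenOpens.measurableE R)).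
move=> _ [_ [a [b ->] <-]]; rewrite setTI comp_preimage.
apply: measurable_Cvec_open; apply: cg; exact: interval_open.
Qed.

Lemma continuous_cmeasurable (f : Cn -> R[i]^o) : continuous f ->
  cmeasurable (f \o @Cvec R n).
Proof.
move=> cf; split.
  apply: (continuous_measurable_Cvec (g := @complex.Re R \o f)) => z.
  by apply: continuous_comp; [exact: cf|exact: continuous_Re].
apply: (continuous_measurable_Cvec (g := @complex.Im R \o f)) => z.
by apply: continuous_comp; [exact: cf|exact: continuous_Im].
Qed.

(** The open set where a continuous function does not vanish, if nonempty,
contains a box, and boxes have positive measure. *)
Lemma continuous_ae_eq0 (f : Cn -> R[i]^o) : continuous f ->
  {ae mu, forall t, f (Cvec t) = 0} -> forall z, f z = 0.
Proof.
move=> /continuousP cf [N [mN N0 fN]] z; apply/eqP/negP => /negP fz.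
have oA : open (f @^-1` [set w | w != 0]).
  apply: cf; rewrite (_ : [set w | w != 0] = ~` [set (0 : R[i]^o)]); last first.
    by apply/seteqP; split => w /= /eqP.
  apply: closed_openC; apply: accessible_closed_set1.
  apply: hausdorff_accessible; exact: norm_hausdorff.
have At : (f @^-1` [set w | w != 0]) (Cvec (tuple_of_Cvec z)).
  by rewrite /= tuple_of_CvecK.
have [pq zpq pqA] := open_ratbox oA At.
have : (0 < mu (ratbox pq))%E.
  apply: (@tuple_measure_box_gt0 _ (measurableTypeR R) R lebesgue_measure).
    by move=> i; exact: measurable_itv.
  move=> i; rewrite /= lebesgue_measure_itv/= lte_fin.
  have := zpq i; rewrite /= in_itv/= => /andP[h1 h2].
  by rewrite (lt_trans h1 h2) lte_fin subr_gt0 (lt_trans h1 h2).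
have : (mu (ratbox pq) <= mu N)%E.
  apply: le_measure; rewrite ?inE//; first exact: measurable_ratbox.
  apply: subset_trans fN => t /pqA/= ft0 /eqP; exact/negP.
by rewrite N0 => /le_lt_trans/[apply]; rewrite ltxx.
Qed.

End continuous_Cn.

(** * Admissible weights *)

Section weights.
Context {R : realType}.
Implicit Types (f psi : R -> R) (x y : R).

(** At an interior point of the half-line the constraint on the increments is
eventually vacuous. *)
Lemma is_derive_hl f y : 0 < y -> derivable_hl f y ->
  is_derive y 1 f (derive_hl f y).
Proof.
move=> y0 df.
have incE : increments y = 0^'.
  rewrite /increments eqEsubset; split => A; last exact: cvg_within.
  rewrite /within/= => yA.
  have yh : \forall h \near (0 : R)^', 0 <= y + h.
    apply: cvg_within; apply/nbhs_ballP; exists y => //= h.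
    by rewrite /ball/= sub0r normrN ltr_norml => /andP[? _]; lra.
  by apply: filterS2 yA yh.
have dqE : (fun h : R => h^-1 *: ((f \o shift y) (h *: 1) - f y)) = dquot f y.
  apply/funext => h; rewrite /dquot /=; congr (_ * (f _ - _)).
  by rewrite addrC [h *: 1]mulr1.
move: df; rewrite /derivable_hl /derive_hl incE => df.
by split; [rewrite /derivable dqE|rewrite /derive dqE].
Qed.

Lemma MVT_hl f x y : 0 < x -> x <= y ->
  (forall z, 0 <= z -> derivable_hl f z) ->
  exists2 c, x <= c & f y - f x = derive_hl f c * (y - x).
Proof.
move=> x0; rewrite le_eqVlt => /predU1P[->|xy] df.
  by exists y => //; rewrite !subrr mulr0.
have dff z : x <= z -> is_derive z 1 f (derive_hl f z).
  move=> xz; have z0 := lt_le_trans x0 xz.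
  by apply: is_derive_hl => //; exact/df/ltW.
have [z||c] := @MVT R f (derive_hl f) x y xy.
- by rewrite in_itv/= => /andP[/ltW xz _]; exact: dff.
- apply: derivable_within_continuous => z; rewrite in_itv/= => /andP[xz _].
  by have [] := dff _ xz.
- by rewrite in_itv/= => /andP[/ltW xc _] fE; exists c.
Qed.

Section admissible.
Variables (n : nat) (psi : R -> R).
Hypothesis psiP : admissible_weight n psi.

(** By convexity psi lies above its tangent line at 1. The base point is 1
rather than 0 so that only interior derivatives enter; below 1 the bound is at
most 0 and psi >= 0 suffices. *)
Lemma admissible_weight_lower :
  exists2 c, 0 < c & forall y, 0 <= y -> c * (y - 1) <= psi y.
Proof.
have [psi0 [dpsi _] dpsi0 _] := psiP.
have c0 : 0 < derive_hl psi 1 by have [] := dpsi0 1 ler01.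
exists (derive_hl psi 1) => // y y0.
have [y1|y1] := leP y 1.
  by apply: le_trans (psi0 _ y0); rewrite pmulr_rle0// subr_le0.
have [c c1 psiE] := MVT_hl (f := psi) ltr01 (ltW y1) (dpsi 0%N isT).
have [d d1 dpsiE] := MVT_hl (f := derive_hl psi) ltr01 c1 (dpsi 1%N isT).
have cdpsi : derive_hl psi 1 <= derive_hl psi c.
  rewrite -subr_ge0 dpsiE mulr_ge0 ?subr_ge0//.
  by have [] := dpsi0 d (le_trans ler01 d1).
have := psi0 1 ler01.
have : derive_hl psi 1 * (y - 1) <= derive_hl psi c * (y - 1).
  by rewrite ler_wpM2r// subr_ge0 ltW.
lra.
Qed.

(** The values of psi at negative reals are arbitrary, hence the truncation. *)
Lemma measurable_admissible_weight :
  measurable_fun setT (fun y : R => if 0 < y then psi y else psi 0).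
Proof.
have [_ [dpsi _] _ _] := psiP.
apply: measurable_fun_if => //; first exact: measurable_fun_ltr.
rewrite (_ : _ `&` _ = `]0, +oo[%classic); last first.
  by apply/seteqP; split => y /=; rewrite in_itv/= andbT => // -[].
apply: open_continuous_measurable_fun; first exact: interval_open.
move=> y; rewrite inE/= in_itv/= andbT => y0.
apply/differentiable_continuous/derivable1_diffP.
by have [] := is_derive_hl y0 (dpsi 0%N isT _ (ltW y0)).
Qed.

Local Notation mu := (@lebesgue_Cn R n).

Lemma weight_gt0 (z : 'cV[R[i]]_n) : 0 < weight psi z.
Proof. exact: expR_gt0. Qed.

Lemma measurable_weight : measurable_fun setT (weight psi \o @Cvec R n).
Proof.
apply: (measurableT_comp (@measurable_expR R)).
apply: (measurableT_comp (@oppr_measurable R setT)).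
rewrite (_ : (fun _ => _) = (fun y => if 0 < y then psi y else psi 0) \o
    (fun t => hnorm (Cvec t) ^+ 2)); last first.
  apply/funext => t /=; case: ltP => //.
  by rewrite le_eqVlt ltNge sqr_ge0 orbF => /eqP ->.
apply: (measurableT_comp measurable_admissible_weight).
under eq_fun do rewrite hnorm_sqr_Cvec.
apply: measurable_sum => i; apply: measurable_funX; exact: measurable_tnth.
Qed.

Lemma le_prod_1Dsqr (m : nat) (x : 'I_m -> R) :
  1 + \sum_(i < m) x i ^+ 2 <= \prod_(i < m) (1 + x i ^+ 2).
Proof.
elim: m x => [|m IHm] x; first by rewrite !big_ord0 addr0.
rewrite !big_ord_recl/=.
have := IHm (x \o lift ord0); rewrite /=.
set s := \sum_(i < m) _; set p := \prod_(i < m) _ => sp.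
have s0 : 0 <= s by apply: sumr_ge0 => i _; exact: sqr_ge0.
have x0 := sqr_ge0 (x ord0).
apply: (@le_trans _ _ ((1 + x ord0 ^+ 2) * (1 + s))); last first.
  by rewrite ler_wpM2l// addr_ge0.
nra.
Qed.

Lemma ler_expR_oneDsqr (c x : R) : 0 < c ->
  (1 + x ^+ 2) * expR (- (c * x ^+ 2)) <= (1 + 2 / c) ^+ 2 * (oneDsqr x)^-1.
Proof.
move=> c0; have x0 := sqr_ge0 x.
have px : 0 < 1 + x ^+ 2 by lra.
rewrite /oneDsqr ler_pdivlMr// mulrAC -expr2 expRN ler_pdivrMr ?expR_gt0//.
have -> : c * x ^+ 2 = 2%:R * (c * x ^+ 2 / 2) by field.
rewrite expRM_natl -exprMn ler_sqr ?nnegrE; last 2 first.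
- by rewrite ltW.
- by rewrite mulr_ge0 ?expR_ge0// addr_ge0// divr_ge0// ltW.
apply: (@le_trans _ _ ((1 + 2 / c) * (1 + c * x ^+ 2 / 2))); last first.
  by rewrite ler_wpM2l ?expR_ge1Dx// addr_ge0// divr_ge0// ltW.
have : 0 <= c * x ^+ 2 / 2 by rewrite divr_ge0// mulr_ge0// ltW.
have -> : (1 + 2 / c) * (1 + c * x ^+ 2 / 2) =
  1 + c * x ^+ 2 / 2 + 2 / c + x ^+ 2 by field; rewrite gt_eqF.
have : 0 <= 2 / c by rewrite divr_ge0// ltW.
lra.
Qed.

(** A product of one-variable functions dominates the integrand: with x the real
coordinates of z, 1 + |z|^2 <= prod_i (1 + x_i^2) and the weight is at most
e^c prod_i exp (- c x_i^2), where (1 + x^2) exp (- c x^2) is bounded by a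
multiple of the integrable function 1 / (1 + x^2). *)
Lemma integral_weight_lt_pinfty :
  (\int[mu]_t ((1 + hnorm (Cvec t) ^+ 2) * weight psi (Cvec t))%:E < +oo)%E.
Proof.
have [c c0 psi_ge] := admissible_weight_lower.
pose K := (1 + 2 / c) ^+ 2.
have K0 : 0 <= K by rewrite exprn_ge0// addr_ge0// divr_ge0// ltW.
pose F (x : R) := K * (oneDsqr x)^-1.
have F0 x : 0 <= F x by rewrite mulr_ge0// invr_ge0 ltW// oneDsqr_gt0.
have cF : continuous F.
  by move=> x; apply: cvgM; [exact: cvg_cst|exact: continuous_oneDsqrV].
have mF : measurable_fun setT F by exact: continuous_measurable_fun.
have mV : measurable_fun setT (fun x : R => (oneDsqr x)^-1).
  by apply: continuous_measurable_fun; exact: continuous_oneDsqrV.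
have intF : (\int[lebesgue_measure]_x (F x)%:E =
    (2 * (K * (pi / 2)))%:E)%E.
  rewrite ge0_symfun_integralT//; last by move=> x; rewrite /F/= /oneDsqr sqrrN.
  rewrite (_ : [set x | _] = `[0, +oo[%classic); last first.
    by apply/seteqP; split => x/=; rewrite in_itv/= andbT.
  under eq_integral do rewrite EFinM.
  rewrite ge0_integralZl//; last first.
    by apply/measurable_EFinP; exact: measurable_funTS.
  by rewrite integral0y_oneDsqr !EFinM.
have mP : measurable_fun setT
    (fun t : (n + n).-tuple R => \prod_(i < n + n) F (tnth t i)).
  exact: (@measurable_fun_prod_tnth _ (measurableTypeR R) R).
apply: (@le_lt_trans _ _
  (\int[mu]_t ((expR c)%:E * (\prod_(i < n + n) F (tnth t i))%:E))%E).
  apply: ge0_le_integral => //.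
  - move=> t _; rewrite lee_fin mulr_ge0// ?expR_ge0// addr_ge0//.
    exact: sqr_ge0.
  - apply/measurable_EFinP/measurable_funM; last exact: measurable_weight.
    apply: measurable_funD => //; under eq_fun do rewrite hnorm_sqr_Cvec.
    apply: measurable_sum => i; apply: measurable_funX.
    exact: measurable_tnth.
  - by apply: emeasurable_funM => //; exact/measurable_EFinP.
  move=> t _; rewrite -EFinM lee_fin.
  have h0 := sqr_ge0 (hnorm (Cvec t)).
  apply: (@le_trans _ _ ((1 + hnorm (Cvec t) ^+ 2) *
      (expR c * expR (- (c * hnorm (Cvec t) ^+ 2))))).
    rewrite ler_wpM2l//; first lra.
    by rewrite -expRD ler_expR; have := psi_ge _ h0; lra.
  rewrite mulrCA ler_wpM2l ?expR_ge0// hnorm_sqr_Cvec.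
  apply: (@le_trans _ _ (\prod_(i < n + n) (1 + tnth t i ^+ 2) *
      expR (- (c * \sum_(i < n + n) tnth t i ^+ 2)))).
    by rewrite ler_wpM2r ?expR_ge0// le_prod_1Dsqr.
  rewrite mulr_sumr -sumrN expR_sum -big_split/=; apply: ler_prod => i _.
  rewrite ler_expR_oneDsqr// andbT mulr_ge0 ?expR_ge0// addr_ge0//.
  exact: sqr_ge0.
rewrite ge0_integralZl//; last 2 first.
- exact/measurable_EFinP.
- by move=> t _; rewrite lee_fin prodr_ge0.
rewrite (@integral_prod_tnth _ (measurableTypeR R) R lebesgue_measure _ F _
  mF F0 intF).
by rewrite -EFinM ltry.
Qed.

End admissible.
End weights.

(** * Holomorphic functions and the weighted Fock space *)

Section fock_space.
Context {R : realType} {n : nat}.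
Local Notation mu := (@lebesgue_Cn R n).
Local Notation Cn := 'cV[R[i]]_n.
Implicit Types (f g h : Cn -> R[i]) (z : Cn) (U : 'M[R[i]]_n).

Definition sqmod (x : R[i]) : R := complex.Re x ^+ 2 + complex.Im x ^+ 2.

Lemma sqmod_ge0 x : 0 <= sqmod x.
Proof. by rewrite addr_ge0// sqr_ge0. Qed.

Lemma sqmodE (x : R[i]) : complex.Re `|x| ^+ 2 = sqmod x.
Proof. by rewrite normc_def/= sqr_sqrtr// sqmod_ge0. Qed.

Lemma sqmod_eq0 x : sqmod x = 0 -> x = 0.
Proof.
case: x => a b /eqP; rewrite /sqmod/= paddr_eq0 ?sqr_ge0//.
by rewrite !sqrf_eq0 => /andP[/eqP -> /eqP ->].
Qed.

Lemma Re_mulJ (x : R[i]) : complex.Re (x * x^*) = sqmod x.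
Proof.
by rewrite complex_ReM complex_ReJ complex_ImJ mulrN opprK /sqmod !expr2.
Qed.

Lemma holomorphic_continuous g : holomorphic g ->
  continuous (g : 'cV[R[i]^o]_n -> R[i]^o).
Proof. by move=> hg z; exact: (differentiable_continuous (hg z)). Qed.

Definition coordf (j : 'I_n) : Cn -> R[i] := fun z => z j 0.

Lemma holomorphic_cst c : holomorphic (fun _ : Cn => c).
Proof. by move=> z; exact: differentiable_cst. Qed.

Lemma holomorphic_coordf j : holomorphic (coordf j).
Proof. by move=> z; exact: differentiable_coord. Qed.

Lemma holomorphic_lin (a : R[i]) f g :
  holomorphic f -> holomorphic g -> holomorphic (a *: f + g).
Proof.
move=> hf hg z; apply: (differentiableD _ (hg z)).
exact: (differentiableZ a (hf z)).
Qed.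

Lemma holomorphic_row U j : holomorphic (fun z => (U *m z) j 0).
Proof.
have -> : (fun z => (U *m z) j 0) = \sum_k U j k *: coordf k.
  by apply/funext => z; rewrite mxE fct_sumE.
elim/big_rec: _ => [|k f _]; first exact: holomorphic_cst.
exact/holomorphic_lin/holomorphic_coordf.
Qed.

Lemma continuous_mulmx U :
  continuous (mulmx U : 'cV[R[i]^o]_n -> 'cV[R[i]^o]_n).
Proof.
move=> w A [P wP PA].
have : \forall v \near (w : 'cV[R[i]^o]_n), forall j, P j 0 ((U *m v) j 0).
  apply: (@filter_forall _ _ (fun j v => P j 0 ((U *m v) j 0)) _
    (nbhs_filter (w : 'cV[R[i]^o]_n))) => j.
  by apply: (holomorphic_continuous (@holomorphic_row U j)); exact: wP.
by apply: filterS => v Pv; apply: PA => i k; rewrite (ord1 k).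
Qed.

Lemma holomorphic_comp_mulmx g U :
  holomorphic g -> holomorphic (fun z => g (U *m z)).
Proof.
move=> hg z.
have D1 := @linear_differentiable _ _ _ (mulmx U) z (@continuous_mulmx U).
exact: (@differentiable_comp _ _ _ _ (mulmx U) (g : _ -> R[i]^o) z D1
  (hg (U *m z))).
Qed.

End fock_space.

(** * The inner product of the Fock space *)

Section fock_inner_product.
Context {R : realType} {n : nat} {psi : R -> R}.
Hypothesis psiP : admissible_weight n psi.
Local Notation mu := (@lebesgue_Cn R n).
Local Notation Cn := 'cV[R[i]]_n.
Local Notation F2 := (@fock R n psi).
Local Notation ip := (@fock_ip R n psi).
Local Notation w t := (weight psi (@Cvec R n t)).
Implicit Types (f g h : Cn -> R[i]) (z : Cn) (U : 'M[R[i]]_n).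

Lemma fockP g : F2 g <-> holomorphic g /\
  (\int[mu]_t (sqmod (g (Cvec t)) * w t)%:E < +oo)%E.
Proof.
by rewrite /fock/=; under eq_integral do rewrite sqmodE.
Qed.

Lemma fock_cmeasurable g : F2 g -> cmeasurable (g \o @Cvec R n).
Proof.
by move=> [/holomorphic_continuous cg _]; exact: continuous_cmeasurable.
Qed.

Lemma measurable_sqmod d (T : measurableType d) (F : T -> R[i]) :
  cmeasurable F -> measurable_fun setT (fun x => sqmod (F x)).
Proof. by move=> [rF jF]; apply: measurable_funD; exact: measurable_funX. Qed.

Lemma integrable_sqmod g : F2 g ->
  mu.-integrable setT (fun t => (sqmod (g (Cvec t)) * w t)%:E).
Proof.
move=> Fg; have [_ gfin] := (fockP g).1 Fg; apply/integrableP; split.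
  apply/measurable_EFinP/measurable_funM; last exact: measurable_weight psiP.
  exact/measurable_sqmod/fock_cmeasurable.
under eq_integral => t _.
  rewrite gee0_abs; last by rewrite lee_fin mulr_ge0 ?sqmod_ge0// ltW ?expR_gt0.
  over.
exact: gfin.
Qed.

Lemma ler_Re_mulJ (x y : R[i]) :
  `|complex.Re (x * y^*)| <= sqmod x + sqmod y.
Proof.
case: x y => [a b] [c d]; rewrite complex_ReM /sqmod/= ler_norml.
have := (sqr_ge0 a, sqr_ge0 b, sqr_ge0 c, sqr_ge0 d).
move=> [[[? ?] ?] ?].
have := (sqr_ge0 (a + c), sqr_ge0 (b + d), sqr_ge0 (a - c), sqr_ge0 (b - d)).
by move=> [[[? ?] ?] ?]; apply/andP; split; nra.
Qed.

Lemma ler_Im_mulJ (x y : R[i]) :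
  `|complex.Im (x * y^*)| <= sqmod x + sqmod y.
Proof.
case: x y => [a b] [c d]; rewrite complex_ImM /sqmod/= ler_norml.
have := (sqr_ge0 a, sqr_ge0 b, sqr_ge0 c, sqr_ge0 d).
move=> [[[? ?] ?] ?].
have := (sqr_ge0 (a + d), sqr_ge0 (b + c), sqr_ge0 (a - d), sqr_ge0 (b - c)).
by move=> [[[? ?] ?] ?]; apply/andP; split; nra.
Qed.

Definition cintegrable (F : (n + n).-tuple R -> R[i]) :=
  mu.-integrable setT (fun t => (complex.Re (F t) * w t)%:E) /\
  mu.-integrable setT (fun t => (complex.Im (F t) * w t)%:E).

Lemma fock_cintegrable f g : F2 f -> F2 g ->
  cintegrable (fun t => f (Cvec t) * (g (Cvec t))^*).
Proof.
move=> Ff Fg.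
have [mr mi] : cmeasurable (fun t => f (Cvec t) * (g (Cvec t))^*).
  apply: cmeasurableM; first exact: (fock_cmeasurable Ff).
  by apply: cmeasurableJ; exact: (fock_cmeasurable Fg).
have mw := measurable_weight psiP.
have int2 := integrableD measurableT
  (integrable_sqmod Ff) (integrable_sqmod Fg).
have w0 t : 0 < w t by exact: weight_gt0.
split; apply: (le_integrable measurableT _ _ int2).
- exact/measurable_EFinP/measurable_funM.
- move=> t _; rewrite !lee_fin -mulrDl normrM (gtr0_norm (w0 t)).
  rewrite (le_trans _ (ler_norm _))// ler_wpM2r// ?ler_Re_mulJ//.
  exact/ltW/w0.
- exact/measurable_EFinP/measurable_funM.
- move=> t _; rewrite !lee_fin -mulrDl normrM (gtr0_norm (w0 t)).
  rewrite (le_trans _ (ler_norm _))// ler_wpM2r// ?ler_Im_mulJ//.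
  exact/ltW/w0.
Qed.

Lemma sqmod_lin (a x y : R[i]) :
  sqmod (a * x + y) <= 2 * sqmod a * sqmod x + 2 * sqmod y.
Proof.
rewrite /sqmod !raddfD/= complex_ReM complex_ImM.
move: a x y => [a1 a2] [x1 x2] [y1 y2] /=.
have := sqr_ge0 (a1 * x1 - a2 * x2 - y1).
have := sqr_ge0 (a1 * x2 + a2 * x1 - y2).
nra.
Qed.

(** Closure under linear combinations rests on
|a x + y|^2 <= 2 |a|^2 |x|^2 + 2 |y|^2. *)
Lemma fock_lin (a : R[i]) f g : F2 f -> F2 g -> F2 (a *: f + g).
Proof.
move=> Ff Fg; apply/fockP; split.
  by apply: holomorphic_lin; [case: Ff|case: Fg].
have := integrableD measurableT
  (integrableZl measurableT (2 * sqmod a) (integrable_sqmod Ff))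
  (integrableZl measurableT 2 (integrable_sqmod Fg)).
move=> /integrableP[mfg]; apply: le_lt_trans; apply: ge0_le_integral => //.
- by move=> t _; rewrite lee_fin mulr_ge0 ?sqmod_ge0// ltW ?expR_gt0.
- apply/measurable_EFinP/measurable_funM; last exact: measurable_weight psiP.
  apply: measurable_sqmod; apply: cmeasurableD; last exact: fock_cmeasurable.
  by apply: cmeasurableM; [exact: cmeasurable_cst|exact: fock_cmeasurable Ff].
- exact: measurableT_comp.
move=> t _; rewrite lee_fin; apply: le_trans (ler_norm _).
rewrite !mulrA -mulrDl ler_wpM2r ?sqmod_lin//.
by rewrite ltW ?expR_gt0.
Qed.

Lemma fock_ip_linl (a : R[i]) f g h : F2 f -> F2 g -> F2 h ->
  ip (a *: f + g) h = a * ip f h + ip g h.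
Proof.
move=> Ff Fg Fh.
have [fr fi] := fock_cintegrable Ff Fh; have [gr gi] := fock_cintegrable Fg Fh.
pose rf t := complex.Re (f (Cvec t) * (h (Cvec t))^*) * w t.
pose jf t := complex.Im (f (Cvec t) * (h (Cvec t))^*) * w t.
pose rg t := complex.Re (g (Cvec t) * (h (Cvec t))^*) * w t.
pose jg t := complex.Im (g (Cvec t) * (h (Cvec t))^*) * w t.
have Zint (c : R) F : mu.-integrable setT (EFin \o F) ->
    mu.-integrable setT (EFin \o (fun t => c * F t)).
  by move=> iF; apply: (integrableZl measurableT c iF).
have lin (c d : R) F G H : mu.-integrable setT (EFin \o F) ->
    mu.-integrable setT (EFin \o G) -> mu.-integrable setT (EFin \o H) ->
    \int[mu]_t (c * F t + d * G t + H t) =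
    c * \int[mu]_t F t + d * \int[mu]_t G t + \int[mu]_t H t.
  move=> iF iG iH; rewrite RintegralD//; last first.
    exact: (integrableD measurableT (Zint c F iF) (Zint d G iG)).
  by rewrite RintegralD ?RintegralZl//; exact: Zint.
rewrite /fock_ip.
transitivity (
  \int[mu]_t (complex.Re a * rf t + - complex.Im a * jf t + rg t) +i*
  \int[mu]_t (complex.Im a * rf t + complex.Re a * jf t + jg t))%C.
  have FGE t : (a *: f + g) (Cvec t) * (h (Cvec t))^* =
      a * (f (Cvec t) * (h (Cvec t))^*) + g (Cvec t) * (h (Cvec t))^*.
    by rewrite mulrA -mulrDl.
  congr (_ +i* _)%C; apply: eq_Rintegral => t _; rewrite FGE raddfD/=.
    by rewrite complex_ReM /rf /jf /rg; ring.
  by rewrite complex_ImM /rf /jf /jg; ring.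
rewrite !lin//.
case: a => [a1 a2] /=; apply/eqP; rewrite eq_complex/=; apply/andP; split.
  by apply/eqP; rewrite -/rf; lra.
by apply/eqP; lra.
Qed.

Lemma fock_ipC f g : F2 f -> F2 g -> ip g f = (ip f g)^*.
Proof.
move=> Ff Fg; have [_ fi] := fock_cintegrable Ff Fg.
rewrite /fock_ip; apply/eqP; rewrite eq_complex/=; apply/andP; split; apply/eqP.
  apply: eq_Rintegral => t _; congr (_ * _).
  by rewrite !complex_ReM !complex_ReJ !complex_ImJ; lra.
rewrite -mulN1r -RintegralZl//; apply: eq_Rintegral => t _.
by rewrite !complex_ImM !complex_ReJ !complex_ImJ; lra.
Qed.

(** A function of norm 0 vanishes almost everywhere, hence everywhere by
continuity. *)
Lemma fock_ip_eq0 f : F2 f -> complex.Re (ip f f) = 0 -> f = 0.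
Proof.
move=> Ff; rewrite /fock_ip/= => ff0.
have isq := integrable_sqmod Ff.
have sq0 : (\int[mu]_t (sqmod (f (Cvec t)) * w t)%:E = 0)%E.
  rewrite -[LHS]fineK; last exact: integrable_fin_num.
  rewrite -[RHS]/(0%:E) -{}[in RHS]ff0; congr _%:E.
  by apply: eq_Rintegral => t _; rewrite Re_mulJ.
apply/funext => z; apply: continuous_ae_eq0.
  by apply: holomorphic_continuous; case: Ff.
have := (ae_eq_integral_abs mu measurableT (measurable_int mu isq)).1.
have -> : (\int[mu]_t `|(sqmod (f (Cvec t)) * w t)%:E| = 0)%E.
  rewrite -sq0; apply: eq_integral => t _.
  by rewrite gee0_abs// lee_fin mulr_ge0 ?sqmod_ge0// ltW ?expR_gt0.
move=> /(_ erefl); apply: filterS => t /(_ I)/= -[] /eqP.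
by rewrite mulf_eq0 (gt_eqF (weight_gt0 _ _)) orbF => /eqP/sqmod_eq0.
Qed.

Lemma fock_ip_ge0 f : 0 <= complex.Re (ip f f).
Proof.
rewrite /fock_ip/=; apply: Rintegral_ge0 => t _.
by rewrite Re_mulJ mulr_ge0 ?sqmod_ge0// ltW ?expR_gt0.
Qed.

Lemma Rintegral_unitary U (F : Cn -> R) : U \is unitarymx ->
  measurable_fun setT (F \o @Cvec R n) ->
  \int[mu]_t F (U *m Cvec t) = \int[mu]_t F (Cvec t).
Proof.
move=> UU mF; have mEF : measurable_fun setT (EFin \o (F \o @Cvec R n)).
  exact/measurable_EFinP.
rewrite /Rintegral; congr fine; rewrite [LHS]integralE [RHS]integralE.
have UE (phi : \bar R -> \bar R) : (forall x, 0 <= phi x)%E ->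
    measurable_fun setT phi ->
    (\int[mu]_t phi (F (U *m Cvec t))%:E = \int[mu]_t phi (F (Cvec t))%:E)%E.
  move=> phi0 mphi.
  apply: (ge0_integral_unitary UU (F := fun z => phi (F z)%:E)) => //.
  exact: measurableT_comp.
have posE (p : (n + n).-tuple R -> Cn) : (fun t => (F (p t))%:E)^\+%E =
    id^\+%E \o (fun t => (F (p t))%:E) by rewrite -funepos_comp.
have negE (p : (n + n).-tuple R -> Cn) : (fun t => (F (p t))%:E)^\-%E =
    id^\-%E \o (fun t => (F (p t))%:E) by rewrite -funeneg_comp.
rewrite (posE (fun t => U *m Cvec t)) (posE (@Cvec R n)).
rewrite (negE (fun t => U *m Cvec t)) (negE (@Cvec R n)).
congr (_ - _)%E; apply: UE => //.
  exact: measurable_funepos.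
exact: measurable_funeneg.
Qed.

Lemma weight_unitary U z : U \is unitarymx ->
  weight psi (U *m z) = weight psi z.
Proof. by move=> UU; rewrite /weight hnorm_unitary. Qed.

Lemma fock_unitary U f : U \is unitarymx -> F2 f ->
  F2 (fun z => f (U *m z)).
Proof.
move=> UU Ff; have [hf ffin] := (fockP f).1 Ff; apply/fockP; split.
  exact: holomorphic_comp_mulmx.
have [mf _] := integrableP _ _ _ (integrable_sqmod Ff).
pose G z := (sqmod (f z) * weight psi z)%:E.
have G0 z : (0 <= G z)%E.
  by rewrite lee_fin mulr_ge0 ?sqmod_ge0// ltW ?expR_gt0.
apply: le_lt_trans ffin; rewrite le_eqVlt; apply/orP; left; apply/eqP.
transitivity (\int[mu]_t G (U *m Cvec t))%E.
  by apply: eq_integral => t _; rewrite /G weight_unitary.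
exact: (ge0_integral_unitary UU (F := G) mf G0).
Qed.

Lemma fock_ip_unitary U f g : U \is unitarymx -> F2 f -> F2 g ->
  ip (fun z => f (U *m z)) (fun z => g (U *m z)) = ip f g.
Proof.
move=> UU Ff Fg.
have [mr mi] : cmeasurable (fun t => f (Cvec t) * (g (Cvec t))^*).
  apply: cmeasurableM; first exact: (fock_cmeasurable Ff).
  by apply: cmeasurableJ; exact: (fock_cmeasurable Fg).
have mw := measurable_weight psiP.
pose G z := complex.Re (f z * (g z)^*) * weight psi z.
pose H z := complex.Im (f z * (g z)^*) * weight psi z.
rewrite /fock_ip; congr (_ +i* _)%C.
  transitivity (\int[mu]_t G (U *m Cvec t)).
    by apply: eq_Rintegral => t _; rewrite /G weight_unitary.
  by apply: (Rintegral_unitary UU (F := G)); exact: measurable_funM.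
transitivity (\int[mu]_t H (U *m Cvec t)).
  by apply: eq_Rintegral => t _; rewrite /H weight_unitary.
by apply: (Rintegral_unitary UU (F := H)); exact: measurable_funM.
Qed.

Lemma fock_le_1Dhnorm f : holomorphic f ->
  (forall z, sqmod (f z) <= 1 + hnorm z ^+ 2) -> F2 f.
Proof.
move=> hf le_f; apply/fockP; split => //.
apply: le_lt_trans (integral_weight_lt_pinfty psiP).
have mw := measurable_weight psiP.
apply: ge0_le_integral => //.
- by move=> t _; rewrite lee_fin mulr_ge0 ?sqmod_ge0// ltW ?expR_gt0.
- apply/measurable_EFinP/measurable_funM => //; apply: measurable_sqmod.
  by apply: continuous_cmeasurable; exact: holomorphic_continuous.
- apply/measurable_EFinP/measurable_funM => //; apply: measurable_funD => //.
  under eq_fun do rewrite hnorm_sqr_Cvec.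
  by apply: measurable_sum => i; apply: measurable_funX; exact: measurable_tnth.
- by move=> t _; rewrite lee_fin ler_wpM2r// ltW ?expR_gt0.
Qed.

Lemma fock_one : F2 (fun=> 1).
Proof.
apply: fock_le_1Dhnorm; first exact: holomorphic_cst.
by move=> z; rewrite /sqmod/= expr1n expr0n addr0 lerDl sqr_ge0.
Qed.

Lemma fock_coordf j : F2 (coordf j).
Proof.
apply: fock_le_1Dhnorm; first exact: holomorphic_coordf.
move=> z; rewrite -(tuple_of_CvecK z) hnorm_sqr_Cvec big_split_ord/=.
rewrite -big_split/= (bigD1 j)//= /sqmod /coordf mxE/=.
rewrite ler_wpDl// lerDl.
by apply: sumr_ge0 => i _; rewrite addr_ge0// sqr_ge0.
Qed.

End fock_inner_product.

(** * The Gram matrix of the constant and the coordinate functions *)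

Section fock_gram.
(* Membership in [fock] is a conjunction ending in an integral; it is kept
   folded. *)
Local Opaque fock fock_ip.
Context {R : realType} {n : nat} {psi : R -> R}.
Hypothesis psiP : admissible_weight n psi.
Local Notation Cn := 'cV[R[i]]_n.
Local Notation F2 := (@fock R n psi).
Local Notation ip := (@fock_ip R n psi).
Implicit Types (f g h : Cn -> R[i]).

Lemma fock0 : F2 0.
Proof.
by have := fock_lin psiP (-1) (fock_one psiP) (fock_one psiP);
  rewrite scaleN1r addNr.
Qed.

Lemma fock_ip0l h : F2 h -> ip 0 h = 0.
Proof.
move=> Fh; have := fock_ip_linl psiP (-1) Fh Fh Fh.
by rewrite scaleN1r addNr mulN1r addNr.
Qed.

Lemma fock_ipZl (a : R[i]) f h : F2 f -> F2 h -> ip (a *: f) h = a * ip f h.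
Proof.
move=> Ff Fh; have := fock_ip_linl psiP a Ff fock0 Fh.
by rewrite fock_ip0l// !addr0.
Qed.

Lemma fock_ip_suml (I : Type) (r : seq I) (c : I -> R[i])
    (f : I -> Cn -> R[i]) h : (forall i, F2 (f i)) -> F2 h ->
  F2 (\sum_(i <- r) c i *: f i) /\
  ip (\sum_(i <- r) c i *: f i) h = \sum_(i <- r) c i * ip (f i) h.
Proof.
move=> Ff Fh; elim: r => [|i r [Fr ipr]].
  by rewrite !big_nil (fock_ip0l Fh); split; first exact: fock0.
rewrite !big_cons (fock_ip_linl psiP _ (Ff i) Fr Fh) ipr; split; last by [].
exact: (fock_lin psiP _ (Ff i) Fr).
Qed.

Lemma fock_ip_linr (a : R[i]) f g h : F2 f -> F2 g -> F2 h ->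
  ip h (a *: f + g) = a^* * ip h f + ip h g.
Proof.
move=> Ff Fg Fh; rewrite (fock_ipC psiP (fock_lin psiP a Ff Fg) Fh).
rewrite fock_ip_linl// rmorphD rmorphM/=.
by rewrite -(fock_ipC psiP Ff Fh) -(fock_ipC psiP Fg Fh).
Qed.

Lemma fock_ip_neq0 f : F2 f -> f <> 0 -> ip f f != 0.
Proof.
move=> Ff f0; apply/eqP => ff0; apply: f0; apply: (fock_ip_eq0 psiP Ff).
by rewrite ff0.
Qed.

Definition flip_coord (i : 'I_n) : 'M[R[i]]_n :=
  diag_mx (\row_k if k == i then -1 else 1).

Lemma flip_coord_mul i (z : Cn) k :
  (flip_coord i *m z) k 0 = (if k == i then -1 else 1) * z k 0.
Proof. by rewrite mul_diag_mx !mxE. Qed.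

Lemma flip_coord_unitary i : flip_coord i \is unitarymx.
Proof.
apply/unitarymxP/matrixP => j k.
rewrite mul_diag_mx !mxE rmorphMn/= [k == j]eq_sym.
have [->|_] := eqVneq j k; last by rewrite mulr0n rmorph0 mulr0.
by case: ifP => _; rewrite ?rmorphN rmorph1 ?mulrNN mulr1.
Qed.

Lemma perm_mx_unitary (s : {perm 'I_n}) : perm_mx s \is @unitarymx R[i] n n.
Proof.
apply/unitarymxP; rewrite tr_perm_mx map_perm_mx -perm_mxM mulgV.
exact: perm_mx1.
Qed.

(** The unitary flip of the sign of z_i fixes f and negates z_i, so
<z_i, f> = - <z_i, f>. *)
Lemma fock_ip_coordf_odd i f : F2 f ->
  (forall z, f (flip_coord i *m z) = f z) -> ip (coordf i) f = 0.
Proof.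
move=> Ff feven; have UU := flip_coord_unitary i.
have Fi := fock_coordf psiP i.
have := fock_ip_unitary psiP UU Fi Ff.
have -> : (fun z => f (flip_coord i *m z)) = f by apply/funext.
have -> : (fun z : Cn => coordf i (flip_coord i *m z)) = -1 *: coordf i.
  by apply/funext => z; rewrite /coordf flip_coord_mul eqxx.
rewrite fock_ipZl// mulN1r => /eqP; rewrite eq_sym -subr_eq0 opprK.
by rewrite -mulr2n mulrn_eq0/= => /eqP.
Qed.

Lemma fock_ip_coordf_one i : ip (coordf i) (fun=> 1) = 0.
Proof. by apply: fock_ip_coordf_odd => //; exact: fock_one. Qed.

Lemma fock_ip_coordf_neq i j : i != j -> ip (coordf i) (coordf j) = 0.
Proof.
move=> ij; apply: fock_ip_coordf_odd; first exact: fock_coordf.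
by move=> z; rewrite /coordf flip_coord_mul eq_sym (negbTE ij) mul1r.
Qed.

(** A transposition of coordinates is unitary. *)
Lemma fock_ip_coordf_eq i j :
  ip (coordf i) (coordf i) = ip (coordf j) (coordf j).
Proof.
have Fi := fock_coordf psiP i.
rewrite -(fock_ip_unitary psiP (perm_mx_unitary (tperm i j)) Fi Fi).
suff -> : (fun z : Cn => coordf i (perm_mx (tperm i j) *m z)) = coordf j by [].
by apply/funext => z; rewrite /coordf -row_permE mxE tpermL.
Qed.

Lemma coordf_neq0 i : coordf i <> 0 :> (Cn -> R[i]).
Proof.
move=> /(congr1 (fun f => f (delta_mx i 0))); rewrite /coordf mxE !eqxx/=.
by move/eqP; rewrite oner_eq0.
Qed.

End fock_gram.

(** * Co-isometric composition operators *)

Section coisometry_affine.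
(* Membership in [fock] is a conjunction ending in an integral; it is kept
   folded. *)
Local Opaque fock fock_ip.
Context {R : realType} {n : nat} {psi : R -> R}.
Hypothesis psiP : admissible_weight n psi.
Local Notation Cn := 'cV[R[i]]_n.
Local Notation F2 := (@fock R n psi).
Local Notation ip := (@fock_ip R n psi).
Implicit Types (f g h : Cn -> R[i]).

(** Polarization. *)
Lemma isometry_on_Re_ip (T : (Cn -> R[i]) -> Cn -> R[i]) f g :
  bounded_operator F2 ip T -> isometry_on F2 ip T -> F2 f -> F2 g ->
  complex.Re (ip (T f) (T g)) = complex.Re (ip f g).
Proof.
move=> [TF Tlin _] Tiso Ff Fg.
have sqE h : F2 h -> complex.Re (ip (T h) (T h)) = complex.Re (ip h h).
  move=> Fh; have := congr1 (fun x => x ^+ 2) (Tiso h Fh).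
  by rewrite /ipnorm !sqr_sqrtr ?fock_ip_ge0.
have polar f' g' : F2 f' -> F2 g' ->
    complex.Re (ip (1 *: f' + g') (1 *: f' + g')) =
    complex.Re (ip f' f') + complex.Re (ip f' g') *+ 2 + complex.Re (ip g' g').
  move=> Ff' Fg'; have Ffg := fock_lin psiP 1 Ff' Fg'.
  rewrite fock_ip_linl// !fock_ip_linr// (fock_ipC psiP Ff' Fg').
  have ReD (x y : R[i]) : complex.Re (x + y) = complex.Re x + complex.Re y.
    by case: x; case: y.
  by rewrite rmorph1 !mul1r !ReD complex_ReJ mulr2n; ring.
have Ffg := fock_lin psiP 1 Ff Fg.
have [FTf FTg] := (TF _ Ff, TF _ Fg).
have := sqE _ Ffg; rewrite (Tlin 1 f g Ff Fg).
rewrite (polar _ _ FTf FTg) (polar _ _ Ff Fg).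
rewrite (sqE f Ff) (sqE g Fg) => /addIr/addrI/eqP.
by rewrite eqrMn2r// => /eqP.
Qed.

(** With e = g - S T g, Re <e, e> = Re <g, e> - Re <T g, T e> = 0 because T is
an isometry adjoint to S. *)
Lemma coisometry_right_inverse S T :
  bounded_operator F2 ip S -> is_adjoint F2 ip S T -> isometry_on F2 ip T ->
  forall g, F2 g -> S (T g) = g.
Proof.
move=> [SF _ _] [Tb adj] Tiso g Fg.
have [TF Tlin _] := Tb.
have FSTg : F2 (S (T g)) by apply/SF/TF.
pose e := -1 *: S (T g) + g.
have Fe : F2 e by exact: fock_lin.
have /eqP : e = 0.
  apply: (fock_ip_eq0 psiP Fe).
  rewrite {1}/e fock_ip_linl// mulN1r raddfD raddfN/= adj//; last exact: TF.
  by rewrite isometry_on_Re_ip// addNr.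
by rewrite /e scaleN1r addrC subr_eq0 => /eqP.
Qed.

Variables (C : 'M[R[i]]_n) (D : Cn) (Gamma : Cn -> Cn).
Hypothesis GammaE : forall z, Gamma z = C *m z - D.
Hypothesis Gamma_bounded : bounded_operator F2 ip (comp_op Gamma).

(** If C v = 0 then Gamma v = Gamma 0, so every function in the image of the
composition operator takes the same value at v and 0; for the coordinate
functions this says v = 0. *)
Lemma comp_op_surjective_unitmx :
  (forall g, F2 g -> exists f, comp_op Gamma f = g) -> C \in unitmx.
Proof.
move=> surj; rewrite -unitmx_tr -row_free_unit -kermx_eq0.
apply/eqP/matrixP => i j; rewrite [RHS]mxE.
pose v := (row i (kermx C^T))^T.
have Cv : C *m v = 0.
  apply: trmx_inj; rewrite trmx_mul trmxK trmx0.
  by rewrite -row_mul mulmx_ker row0.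
have [f fE] := surj _ (fock_coordf psiP j).
have := congr1 (fun h => h v) fE; have := congr1 (fun h => h 0) fE.
rewrite /comp_op/= !GammaE Cv mulmx0 => -> /esym.
by rewrite /coordf !mxE.
Qed.

(** Invertibility of C makes Gamma onto, hence composition with Gamma injective.
Its right inverse T is then a left inverse as well, and
<S f, S g> = <f, T S g> = <f, g>. *)
Lemma coisometry_affine_isometry f g :
  coisometry F2 ip (comp_op Gamma) -> F2 f -> F2 g ->
  ip (comp_op Gamma f) (comp_op Gamma g) = ip f g.
Proof.
move=> [T Tadj Tiso] Ff Fg; have [Tb adj] := Tadj; have [TF _ _] := Tb.
have ST := coisometry_right_inverse Gamma_bounded Tadj Tiso.
have Cunit : C \in unitmx.
  by apply: comp_op_surjective_unitmx => h Fh; exists (T h); exact: ST.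
have [SF _ _] := Gamma_bounded.
rewrite adj//; last exact: SF.
have inj h h' : comp_op Gamma h = comp_op Gamma h' -> h = h'.
  move=> hh'; apply/funext => w.
  have := congr1 (fun k => k (invmx C *m (w + D))) hh'.
  by rewrite /comp_op/= GammaE mulKVmx// addrK.
by congr (ip f _); apply: inj; apply: ST; exact: SF.
Qed.

Lemma coisometry_affine_unitary :
  coisometry F2 ip (comp_op Gamma) -> D = 0 /\ C \is unitarymx.
Proof.
move=> coiso; have iso f g := @coisometry_affine_isometry f g coiso.
have F1 := fock_one psiP; have Fc := fock_coordf psiP.
have D0 : D = 0.
  apply/colP => j; rewrite [RHS]mxE.
  have := iso _ _ (Fc j) F1; rewrite fock_ip_coordf_one//.
  have -> : comp_op Gamma (coordf j) =
      - D j 0 *: (fun=> 1) + \sum_k C j k *: coordf k.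
    apply/funext => z.
    transitivity (- D j 0 * 1 + \sum_k C j k * z k 0).
      by rewrite /comp_op/= /coordf GammaE !mxE mulr1 addrC.
    rewrite -[RHS]/(- D j 0 * 1 + (\sum_k C j k *: coordf k) z).
    by rewrite fct_sumE.
  have [Fs sE] := fock_ip_suml psiP (index_enum 'I_n) (C j) Fc F1.
  rewrite fock_ip_linl// sE big1 ?addr0 => [/eqP|k _]; last first.
    by rewrite fock_ip_coordf_one// mulr0.
  rewrite mulf_eq0 oppr_eq0 => /orP[/eqP//|].
  rewrite (negbTE (fock_ip_neq0 psiP F1 _))//.
  by move=> /(congr1 (fun f => f 0))/eqP; rewrite oner_eq0.
split => //; apply/unitarymxP/matrixP => i j.
pose a := ip (coordf i) (coordf i).
have a0 : a != 0 by exact: (fock_ip_neq0 psiP (Fc i) (@coordf_neq0 R n i)).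
have aC : a^* = a by rewrite /a -(fock_ipC psiP (Fc i) (Fc i)).
have SE k : comp_op Gamma (coordf k) = \sum_l C k l *: coordf l.
  apply/funext => z; rewrite /comp_op/= /coordf GammaE D0 subr0 !mxE.
  by rewrite fct_sumE.
have gram k l : ip (coordf k) (coordf l) = a * (k == l)%:R.
  have [<-|kl] := eqVneq k l.
    by rewrite mulr1 (fock_ip_coordf_eq psiP k i).
  by rewrite fock_ip_coordf_neq// mulr0.
apply: (mulfI a0); rewrite [1%:M i j]mxE.
have := iso _ _ (Fc i) (Fc j); rewrite gram => <-.
have row_ip k l : ip (coordf k) (comp_op Gamma (coordf l)) = a * (C l k)^*.
  have [Fs sE] := fock_ip_suml psiP (index_enum 'I_n) (C l) Fc (Fc k).
  rewrite SE (fock_ipC psiP Fs (Fc k)) sE (bigD1 k)//= big1 ?addr0 => [|m mk].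
    by rewrite gram eqxx mulr1 rmorphM/= aC mulrC.
  by rewrite gram (negbTE mk) !mulr0.
have Fj : F2 (comp_op Gamma (coordf j)).
  by have [SF _ _] := Gamma_bounded; exact: SF.
have [_ sE] := fock_ip_suml psiP (index_enum 'I_n) (C i) Fc Fj.
rewrite [in RHS]SE sE mxE mulr_sumr; apply: eq_bigr => k _.
by rewrite row_ip !mxE mulrCA.
Qed.

Lemma unitary_coisometry :
  D = 0 -> C \is unitarymx -> coisometry F2 ip (comp_op Gamma).
Proof.
move=> D0 CU; pose V := invmx C.
have VU : V \is unitarymx by rewrite /V (invmx_unitary CU) trmxC_unitary.
have CV : V *m C = 1%:M by exact: mulVmx (unitarymx_unit CU).
have iso f : F2 f -> ipnorm ip (comp_op (mulmx V) f) = ipnorm ip f.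
  by move=> Ff; rewrite /ipnorm /comp_op (fock_ip_unitary psiP VU Ff Ff).
exists (comp_op (mulmx V)) => //; split.
  split => //; first by move=> f Ff; exact: fock_unitary.
  by exists 1 => f Ff; rewrite mul1r iso.
move=> f g Ff Fg.
rewrite -(fock_ip_unitary psiP CU Ff (fock_unitary psiP VU Fg)).
congr (ip _ _); apply/funext => z; rewrite /comp_op/=.
  by rewrite GammaE D0 subr0.
by rewrite mulmxA CV mul1mx.
Qed.

End coisometry_affine.

Theorem theorem3p1 (R : realType) (n : nat) (psi : R -> R)
    (C : 'M[R[i]]_n) (D : 'cV[R[i]]_n) (Gamma : 'cV[R[i]]_n -> 'cV[R[i]]_n) :
  (0 < n)%N ->
  admissible_weight n psi ->
  opnorm C <= 1 ->
  (forall z, Gamma z = C *m z - D) ->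
  bounded_operator (fock psi) (fock_ip psi) (comp_op Gamma) ->
  coisometry (fock psi) (fock_ip psi) (comp_op Gamma) <->
  D = 0 /\ C \is unitarymx.
Proof.
move=> _ psiP _ GammaE Gamma_bounded; split => [|[D0 CU]].
  exact: coisometry_affine_unitary.
exact: (unitary_coisometry psiP GammaE D0 CU).
Qed.
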